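(* Let $n\geq 5$. The normal closure in $B'_n$ of the element $(\sigma_2\sigma_1^{-1})^2$ is $B'_n$.
   Context: $B_n$ denotes the Artin braid group on $n$ strands, with standard generators $\sigma_1,\dots,\sigma_{n-1}$ and relations $\sigma_i\sigma_{i+1}\sigma_i=\sigma_{i+1}\sigma_i\sigma_{i+1}$ for $1\le i\le n-2$ and $\sigma_i\sigma_j=\sigma_j\sigma_i$ for $|i-j|\geq 2$. $B'_n=[B_n,B_n]$ is its commutator subgroup. The normal closure in $B'_n$ of an element $x\in B'_n$ is the smallest subgroup of $B'_n$ that contains $x$ and is normal in $B'_n$ (i.e. only conjugation by elements of $B'_n$ is used). *)

(* Defs.v *)
From HB Require Import structures.
From mathcomp Require Import all_boot.
From mathcomp Require Import boolp classical_sets.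

Set Implicit Arguments.
Unset Strict Implicit.
Unset Printing Implicit Defensive.

Local Open Scope classical_set_scope.
Local Open Scope group_scope.
Local Open Scope quotient_scope.

Section Presentation.
Variables (S : choiceType).

(* The letter (s, true) stands for s and (s, false) for its inverse. *)
Definition word := seq (S * bool).

Definition letterV (l : S * bool) := (l.1, ~~ l.2).
Definition wordV (w : word) : word := rev (map letterV w).

Variable R : word -> word -> Prop.

Inductive pres_eq : word -> word -> Prop :=
| pres_refl w : pres_eq w w
| pres_sym u v : pres_eq u v -> pres_eq v u
| pres_trans v u w : pres_eq u v -> pres_eq v w -> pres_eq u w
| pres_cat u u' v v' :
    pres_eq u u' -> pres_eq v v' -> pres_eq (u ++ v) (u' ++ v')
| pres_cancel l : pres_eq [:: l; letterV l] [::]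
| pres_rel u v : R u v -> pres_eq u v.

Definition pres_eqb : rel word := fun u v => `[< pres_eq u v >].

Lemma pres_eqb_refl : reflexive pres_eqb.
Proof. by move=> w; apply/asboolP; apply: pres_refl. Qed.

Lemma pres_eqb_sym : symmetric pres_eqb.
Proof. by move=> u v; apply/asboolP/asboolP; apply: pres_sym. Qed.

Lemma pres_eqb_trans : transitive pres_eqb.
Proof.
by move=> v u w /asboolP uv /asboolP vw; apply/asboolP; apply: pres_trans uv vw.
Qed.

Canonical pres_equiv :=
  EquivRel pres_eqb pres_eqb_refl pres_eqb_sym pres_eqb_trans.

(* The group < S | u = v for all u, v such that R u v >. *)
Definition pres_group : Type := {eq_quot pres_equiv}.

HB.instance Definition _ := Choice.on pres_group.
HB.instance Definition _ := EqQuotient.on pres_group.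

Definition pres_class (w : word) : pres_group := \pi_pres_group w.

Lemma pres_classP u v : pres_class u = pres_class v <-> pres_eq u v.
Proof.
split=> [/eqP|uv]; first by rewrite eqmodE => /asboolP.
by apply/eqP; rewrite eqmodE; apply/asboolP.
Qed.

Lemma pres_classK x : pres_class (repr x) = x.
Proof. exact: reprK. Qed.

Lemma letterVK : involutive letterV.
Proof. by case=> s b; rewrite /letterV /= negbK. Qed.

Lemma wordVK : involutive wordV.
Proof. by move=> w; rewrite /wordV map_rev revK mapK //; apply: letterVK. Qed.

Lemma pres_eqV w : pres_eq (w ++ wordV w) [::].
Proof.
elim: w => [|l w IHw]; first exact: pres_refl.
rewrite /wordV /= rev_cons -cats1 catA -/(wordV w).
apply: pres_trans (pres_cancel l).
apply: (pres_cat (u := [:: l]) (u' := [:: l])); first exact: pres_refl.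
by apply: (pres_cat (v' := [:: letterV l])) IHw (pres_refl _).
Qed.

Lemma wordV_eq u v : pres_eq u v -> pres_eq (wordV u) (wordV v).
Proof.
move=> uv; apply: (pres_trans (v := wordV u ++ (v ++ wordV v))).
  rewrite -[X in pres_eq X _]cats0.
  by apply: pres_cat (pres_refl _) (pres_sym (pres_eqV _)).
rewrite catA -[X in pres_eq _ X]cat0s; apply: pres_cat (pres_refl _).
apply: (pres_trans (v := wordV u ++ u)); last first.
  by rewrite -{2}[u]wordVK; apply: pres_eqV.
by apply: pres_cat (pres_refl _) (pres_sym uv).
Qed.

Definition pres_mul (x y : pres_group) := pres_class (repr x ++ repr y).
Definition pres_one := pres_class [::].
Definition pres_inv (x : pres_group) := pres_class (wordV (repr x)).

Lemma repr_pres_class w : pres_eq (repr (pres_class w)) w.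
Proof. by apply/pres_classP; apply: pres_classK. Qed.

Lemma pres_mulE u v :
  pres_mul (pres_class u) (pres_class v) = pres_class (u ++ v).
Proof. by apply/pres_classP; apply: pres_cat; apply: repr_pres_class. Qed.

Lemma pres_invE u : pres_inv (pres_class u) = pres_class (wordV u).
Proof. by apply/pres_classP; apply: wordV_eq; apply: repr_pres_class. Qed.

Lemma pres_mulA : associative pres_mul.
Proof.
move=> x y z; rewrite -[x]pres_classK -[y]pres_classK -[z]pres_classK.
by rewrite !pres_mulE catA.
Qed.

Lemma pres_mul1 : left_id pres_one pres_mul.
Proof. by move=> x; rewrite -[x]pres_classK pres_mulE. Qed.

Lemma pres_mulr1 : right_id pres_one pres_mul.
Proof. by move=> x; rewrite -[x]pres_classK pres_mulE cats0. Qed.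

Lemma pres_mulrV : right_inverse pres_one pres_inv pres_mul.
Proof.
move=> x; rewrite -[x]pres_classK pres_invE pres_mulE.
by apply/pres_classP; apply: pres_eqV.
Qed.

Lemma pres_mulVr : left_inverse pres_one pres_inv pres_mul.
Proof.
move=> x; rewrite -[x]pres_classK pres_invE pres_mulE.
by apply/pres_classP; rewrite -{2}[repr x]wordVK; apply: pres_eqV.
Qed.

HB.instance Definition _ := isGroup.Build pres_group
  pres_mulA pres_mul1 pres_mulr1 pres_mulVr pres_mulrV.

Definition pres_gen (s : S) : pres_group := pres_class [:: (s, true)].

Definition word_eval (G : groupType) (f : S -> G) (w : word) : G :=
  foldr (fun l x => (if l.2 then f l.1 else (f l.1)^-1) * x) 1 w.

Lemma word_eval_cat (G : groupType) (f : S -> G) u v :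
  word_eval f (u ++ v) = word_eval f u * word_eval f v.
Proof. by elim: u => [|l u IHu] /=; rewrite ?mul1g // IHu mulgA. Qed.

Lemma pres_classE w : pres_class w = word_eval pres_gen w.
Proof.
elim: w => [//|[s b] w IHw] /=.
rewrite -IHw -cat1s -pres_mulE; case: b => //.
by congr (_ * _); rewrite -[[:: _]]/(wordV [:: (s, true)]) -pres_invE.
Qed.

Lemma pres_gen_rel u v :
  R u v -> word_eval pres_gen u = word_eval pres_gen v.
Proof. by move=> uv; rewrite -!pres_classE; apply/pres_classP/pres_rel. Qed.

Lemma pres_group_universal (G : groupType) (f : S -> G) :
    (forall u v, R u v -> word_eval f u = word_eval f v) ->
  exists! phi : pres_group -> G,
    (forall x y, phi (x * y) = phi x * phi y) /\
    (forall s, phi (pres_gen s) = f s).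
Proof.
move=> fR; have f_eq u v : pres_eq u v -> word_eval f u = word_eval f v.
  elim=> {u v} // [v u w _ -> _ -> //|u u' v v' _ eu _ ev|[s []]].
  - by rewrite !word_eval_cat eu ev.
  - by rewrite /= mulg1 mulgV.
  - by rewrite /= mulg1 mulVg.
have fE w : word_eval f (repr (pres_class w)) = word_eval f w.
  by apply: f_eq; apply: repr_pres_class.
exists (fun x => word_eval f (repr x)); split.
  split=> [x y|s]; last by rewrite fE /= mulg1.
  by rewrite -word_eval_cat; apply: fE.
move=> phi [phiM phi_gen]; apply/funext => x.
have phi1 : phi 1 = 1 by apply: (mulgI (phi 1)); rewrite -phiM !mulg1.
have phiV y : phi y^-1 = (phi y)^-1.
  by apply: (mulgI (phi y)); rewrite -phiM !mulgV.
rewrite -{2}[x]pres_classK pres_classE.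
elim: (repr x) => [|[s b] w IHw] /=; first by rewrite phi1.
by rewrite phiM -IHw; case: b; rewrite ?phiV phi_gen.
Qed.

End Presentation.

Section Braid.
Variable n : nat.

(* The index i : 'I_n.-1, counted from 0, stands for sigma_{i+1}. *)
Inductive braid_rel : word 'I_n.-1 -> word 'I_n.-1 -> Prop :=
| braid_rel3 (i j : 'I_n.-1) : j = i.+1 :> nat ->
    braid_rel [:: (i, true); (j, true); (i, true)]
              [:: (j, true); (i, true); (j, true)]
| braid_relC (i j : 'I_n.-1) : (i.+2 <= j) || (j.+2 <= i) ->
    braid_rel [:: (i, true); (j, true)] [:: (j, true); (i, true)].

Definition braid_group : Type := pres_group braid_rel.

HB.instance Definition _ := Group.on braid_group.

(* sigma k is the standard generator sigma_k for 0 < k < n; it is given the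
   junk value 1 for the other k. *)
Definition sigma (k : nat) : braid_group :=
  if k is i.+1 then
    if insub i is Some j then pres_gen braid_rel j else 1
  else 1.

Lemma sigmaE (i : 'I_n.-1) : sigma i.+1 = pres_gen braid_rel i.
Proof. by rewrite /sigma valK. Qed.

Lemma sigma_braid i : 0 < i -> i.+1 < n ->
  sigma i * sigma i.+1 * sigma i = sigma i.+1 * sigma i * sigma i.+1.
Proof.
case: i => // i _ lt_in; have lt_i1 : i.+1 < n.-1 by case: n lt_in.
have /= := pres_gen_rel (@braid_rel3 (Ordinal (ltnW lt_i1)) (Ordinal lt_i1) erefl).
by rewrite !mulg1 -!sigmaE /= !mulgA.
Qed.

Lemma sigma_comm i j : 0 < i < n -> 0 < j < n ->
  (i.+2 <= j) || (j.+2 <= i) -> sigma i * sigma j = sigma j * sigma i.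
Proof.
case: i j => [//|i] [//|j] /= lt_in lt_jn ij.
have [lti ltj] : i < n.-1 /\ j < n.-1 by case: n lt_in lt_jn.
have /= := pres_gen_rel (@braid_relC (Ordinal lti) (Ordinal ltj) ij).
by rewrite !mulg1 -!sigmaE.
Qed.

End Braid.

Section Subgroups.
Variable G : groupType.
Implicit Types H N : set G.

Definition is_subgroup H : Prop :=
  [/\ H 1, forall x y, H x -> H y -> H (x * y) & forall x, H x -> H x^-1].

Definition generated (A : set G) : set G := smallest is_subgroup A.

Definition derived_subgroup : set G :=
  generated [set z | exists x y, z = [~ x, y]].

Definition normal_subgroup_of H N : Prop :=
  [/\ is_subgroup N, N `<=` H & forall h x, H h -> N x -> N (x ^ h)].

(* Only conjugation by elements of H is used.  Meaningful when H is a subgroup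
   containing x; otherwise the intersection may be empty, hence everything. *)
Definition normal_closure_in H (x : G) : set G :=
  smallest (normal_subgroup_of H) [set x].

End Subgroups.

Arguments derived_subgroup G : clear implicits.

Lemma derived_subgroup_subgroup (G : groupType) :
  is_subgroup (derived_subgroup G).
Proof.
split=> [A [[]] //|x y Hx Hy A AP|x Hx A AP].
  by have [[_ AM _] _] := AP; apply: AM; [apply: Hx|apply: Hy].
by have [[_ _ AV] _] := AP; apply: AV; apply: Hx.
Qed.

Lemma normal_closure_inP (G : groupType) (H : set G) x :
  is_subgroup H -> H x ->
  normal_subgroup_of H (normal_closure_in H x) /\ normal_closure_in H x x.
Proof.
move=> sH Hx; split; last by apply: sub_gen_smallest.
have [H1 HM HV] := sH; split; first split.
- by move=> N [[[]]].
- move=> y z Ny Nz N NP; have [[[_ NM _] _ _] _] := NP.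
  by apply: NM; [apply: Ny|apply: Nz].
- by move=> y Ny N NP; have [[[_ _ NV] _ _] _] := NP; apply: NV; apply: Ny.
- move=> y; apply; split; last by move=> z ->.
  by split=> // h z Hh Hz; rewrite conjgE; apply/HM/HM => //; apply: HV.
- by move=> h y Hh Ny N NP; have [[_ _ NJ] _] := NP; apply: NJ => //; apply: Ny.
Qed.

Lemma sigma_quot_derived n : 4 < n ->
  derived_subgroup (braid_group n) ((sigma n 2 * (sigma n 1)^-1) ^+ 2).
Proof.
move=> n_gt4; have [_ HM _] := derived_subgroup_subgroup (braid_group n).
suff H1 : derived_subgroup (braid_group n) (sigma n 2 * (sigma n 1)^-1).
  by rewrite expgS expg1; apply: HM.
move=> A [_ A_comm]; apply: A_comm.
have s121 := @sigma_braid n 1 isT (ltnW (ltnW n_gt4)).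
set a := sigma n 1 in s121 *; set b := sigma n 2 in s121 *.
exists (a * b)^-1, a^-1; rewrite commgEl conjgE !invgK.
by rewrite !mulgA s121 -(mulgA b) mulgK.
Qed.

(* Main.v *)
From HB Require Import structures.
Require Import Defs.
From mathcomp Require Import all_boot.
From mathcomp Require Import boolp classical_sets.

(** Write [s_i] for [sigma n i], [x] for [(s_2 s_1^-1)^2], [B'] for the
    commutator subgroup of [B_n], and [N] for the normal closure of [x] in [B'].

    The first point is that [N] is normal in the whole of [B_n].  All generators
    have the same image in the abelianization, so every braid is a power of
    [s_4] times an element of [B'], and [s_4] commutes with [x].  Hence every
    conjugate of [x] by a braid is already a conjugate by an element of [B']
    ([exists_commute_coset], [normal_closure_normal]).

    It remains to see that [B_n / N] is abelian.  Let [a, b, c] be the images of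
    [s_1, s_2, s_3] in it.  Then [v := a^-1 b] is an involution, and the braid
    relation says that the conjugate of [v] by [a] is the product of [v] and
    its conjugate by [a^2].  So the conjugates of [v] by powers of [a] form,
    with [1], a quotient of the Klein four-group on which [a] acts with order
    dividing 3, and
    [<a, b>] is a quotient of the semidirect product of that group by an
    infinite cyclic one ([braid_involutionE]).  In particular [a^3 = b^3] is
    central in [<a, b>], and the pure braid [b a^2 b], which winds the third
    strand around the first two, equals [a^4].  One strand further, the pure
    braid [c b a^2 b c] commutes with [b], and it equals [a c^-1] up to a factor
    commuting with [b].  That [b] commutes with [a c^-1] makes the square of
    [a c^-1] trivial, while its cube is [a^3 c^-3 = 1]; so [a = c]
    ([braid_outer_eq]).

    The fifth strand serves once more: [s_3], having the same image as
    [s_1], commutes with [s_4] in the quotient, and two elements that commute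
    and satisfy the braid relation are equal.  The equality spreads along the
    chain of generators, and the quotient is abelian ([sigma_morph_comm]). *)

Set Implicit Arguments.
Unset Strict Implicit.
Unset Printing Implicit Defensive.

Local Open Scope classical_set_scope.
Local Open Scope group_scope.

(** * Elements satisfying the braid relations *)

Section BraidTriples.
Variable G : groupType.
Implicit Types a b c : G.

Lemma braid_commute_eq a b : a * b * a = b * a * b -> commute a b -> a = b.
Proof. by move=> bab ab; apply: (mulgI (a * b)); rewrite bab ab. Qed.

(** With [v_i] the conjugate of [v] by [a^i], the braid relation reads
    [v_1 = v_2 v_0].  As the [v_i] are involutions, [v_0] and [v_2] commute, and
    applying the same relation one index higher gives [v_3 = v_2 v_1 = v_0]. *)
Lemma braid_involutionE a b (v := a^-1 * b) :
    a * b * a = b * a * b -> (b * a^-1) ^+ 2 = 1 ->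
  v * v = 1 /\ commute v (a ^+ 3).
Proof.
move=> bab x2.
have vv : v * v = 1.
  have -> : v * v = ((b * a^-1) ^+ 2) ^ a by rewrite conjgE expg2 !gnorm.
  by rewrite x2 conj1g.
split=> //; set v1 := v ^ a; set v2 := v1 ^ a; set v3 := v2 ^ a.
have v1v1 : v1 * v1 = 1 by rewrite -conjMg vv conj1g.
have vV : v^-1 = v by apply: mulg1_eq.
have v1V : v1^-1 = v1 by apply: mulg1_eq.
have v2V : v2^-1 = v2 by rewrite -conjVg v1V.
have v1E : v1 = v2 * v.
  have v2vE : v2 * v = a ^- 3 * (b * a * b).
    by rewrite /v2 /v1 !conjgE expgS expg2 !gnorm.
  by rewrite v2vE -bab /v1 !conjgE expgS expg2 !gnorm.
have v1E' : v1 = v * v2 by rewrite -v1V v1E invgM vV v2V.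
have v3E : v3 = v.
  have : v2 = v3 * v1 by rewrite /v2 {1}v1E conjMg.
  move/(canLR (mulgK _)) => <-.
  by rewrite v1V v1E' mulgA -v1E v1E' -{2}v2V mulgK.
by apply/commgP/conjg_fixP; rewrite expgS expg2 !conjgM -/v3 v3E.
Qed.

Section ThreeStrands.
Variables a b : G.
Hypotheses (bab : a * b * a = b * a * b) (x2 : (b * a^-1) ^+ 2 = 1).

Lemma braid_cubeC : commute b (a ^+ 3).
Proof.
have [_ v_a3] := braid_involutionE bab x2; rewrite -[b](mulVKg a).
by apply/commute_sym/commuteM; apply: commute_sym => //; apply: commuteX.
Qed.

(** The elements [a] and [b] are conjugate under [a b], which commutes with
    [a^3]. *)
Lemma braid_cube_eq : b ^+ 3 = a ^+ 3.
Proof.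
have -> : b = a ^ (a * b)^-1 by rewrite conjgE invgK mulgA bab !gnorm.
rewrite -conjXg; apply/conjg_fixP/commgP; apply: commuteV.
by apply: commuteM; apply: commute_sym; [apply: commuteX|apply: braid_cubeC].
Qed.

(** Substituting [b = a v] turns the left-hand side into [a v a^3 v]. *)
Lemma braid_strandE : b * a ^+ 2 * b = a ^+ 4.
Proof.
have [vv v_a3] := braid_involutionE bab x2.
set v := a^-1 * b in vv v_a3; have bE : b = a * v by rewrite mulVKg.
clearbody v.
have -> : b * a ^+ 2 * b = a * (v * a ^+ 3) * v.
  by rewrite [in LHS]bE -!mulgA.
by rewrite v_a3 mulgA -(expgS a 3) -mulgA vv mulg1.
Qed.

End ThreeStrands.

(** On four strands the relation identifies the two outer generators.  The
    pure braid [c b a^2 b c] winds the fourth strand around the first three, so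
    it commutes with [b]; modulo the relation it is [a c^-1 a^6]. *)
Lemma braid_outer_eq a b c :
    a * b * a = b * a * b -> b * c * b = c * b * c -> commute a c ->
  (b * a^-1) ^+ 2 = 1 -> a = c.
Proof.
(* Conjugation by [g] shifts the pair (a, b) to (b, c), so that the lemmas on
   three strands also apply to (b, c). *)
move=> bab cbc ac x2; pose g := (a * b * c)^-1.
have ga : a ^ g = b.
  have gaE : a * b * c * a = b * (a * b * c).
    by rewrite -(mulgA _ c) -ac !mulgA bab.
  by rewrite conjgE invgK mulgA gaE mulgK.
have gb : b ^ g = c.
  have gbE : a * b * c * b = c * (a * b * c).
    by rewrite -(mulgA a) -(mulgA a) cbc !mulgA ac.
  by rewrite conjgE invgK mulgA gbE mulgK.
have y2 : (c * b^-1) ^+ 2 = 1.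
  by rewrite -gb -{2}ga -conjVg -conjMg -conjXg x2 conj1g.
have b3 := braid_cube_eq bab x2; have c3 := braid_cube_eq cbc y2.
have b_a3 := braid_cubeC bab x2.
have b_u : commute b (a * c^-1).
  have b_cbaabc : commute b (c * (b * a ^+ 2 * b) * c).
    have := commuteX 2 (commute_sym ac); move: (a ^+ 2) => t ct.
    rewrite /commute !mulgA cbc -(mulgA _ c t) ct.
    by rewrite !mulgA -[in RHS](mulgA _ b c) -[in RHS](mulgA _ _ b) cbc !mulgA.
  rewrite braid_strandE // in b_cbaabc.
  have caac : c * a ^+ 4 * c = a * c^-1 * a ^+ 3 * a ^+ 3.
    rewrite (commuteX 4 (commute_sym ac)) (expgS a 3) -b3 -c3.
    by rewrite -!mulgA mulKg.
  rewrite caac in b_cbaabc.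
  rewrite -[_ * c^-1](mulgK (a ^+ 3)); apply: commuteM; last exact: commuteV.
  rewrite -[_ * a ^+ 3](mulgK (a ^+ 3)); apply: commuteM; last exact: commuteV.
  exact: b_cbaabc.
have [vv _] := braid_involutionE bab x2.
have [ww _] := braid_involutionE cbc y2.
set v := a^-1 * b in vv; set w := b^-1 * c in ww.
have vV : v^-1 = v by apply: mulg1_eq.
have wV : w^-1 = w by apply: mulg1_eq.
have ac' : commute a c^-1 by apply: commuteV.
(* [a c^-1] is a product of two involutions and commutes with one of them, so
   it is itself an involution. *)
have uE : a * c^-1 = w * v.
  by rewrite -vV -wV ac' !gnorm.
have v_u : commute (a * c^-1) v.
  apply: commuteM; last exact: commute_sym.
  by apply/commuteV/commute_sym; apply: commuteM.
have vw : v * w = w * v.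
  by apply: (mulIg v); rewrite -mulgA -uE -v_u uE.
have u3 : (a * c^-1) ^+ 3 = 1 by rewrite expgnFl // c3 b3 mulgV.
have u2 : (a * c^-1) ^+ 2 = 1.
  by rewrite expg2 uE -{1}vw -mulgA (mulgA w) ww mul1g vv.
apply: divg1_eq.
by rewrite expgS u2 mulg1 in u3.
Qed.

End BraidTriples.

(** * Quotients and normal closures *)

Section NormalClosure.
Variable G : groupType.
Implicit Types N H : set G.

(** The quotient [G / N] is the group presented by the elements of [G] as
    generators, with all pairs of words whose values agree modulo [N] as
    relations.  These pairs already form a congruence, so the presentation
    introduces no further relation. *)
Lemma normal_quotient N : normal_subgroup_of setT N ->
  exists (Q : groupType) (f : UMagmaMorphism.type G Q),
    forall x, f x = 1 <-> N x.
Proof.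
case=> [[N1 NM NV] _ NJ].
have NJV x y : N x -> N (y * x * y^-1).
  by move=> Nx; rewrite -mulgA -{1}[y]invgK -conjgE; apply: NJ.
pose R (u v : word G) := N (word_eval id u * (word_eval id v)^-1).
have R_eq u v : pres_eq R u v -> R u v.
  elim=> {u v} // [w|u v _|v u w _ uv _ vw|u u' v v' _ uu' _ vv'|[x [] ]];
    rewrite /R.
  - by rewrite mulgV.
  - by move/NV; rewrite invgM invgK.
  - by rewrite -(divgKA (word_eval id v) (word_eval id u)); apply: NM.
  - rewrite !word_eval_cat; set p := word_eval _ u; set q := word_eval _ v.
    have -> r s : p * q * (r * s)^-1 = (p * (q * s^-1) * p^-1) * (p * r^-1).
      by rewrite !gnorm.
    by apply: NM => //; apply: NJV.
  - by rewrite /= !gnorm.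
  - by rewrite /= !gnorm.
pose f x := pres_gen R x.
have fM : {morph f : x y / x * y}.
  move=> x y; rewrite [RHS]pres_mulE.
  by apply/pres_classP/pres_rel; rewrite /R /= !gnorm.
have f1 : f 1 = 1 by apply/pres_classP/pres_rel; rewrite /R /= !gnorm.
pose fmor := isUMagmaMorphism.Build G (pres_group R) f (f1, fM).
pose F : UMagmaMorphism.type G (pres_group R) := HB.pack f fmor.
exists (pres_group R : groupType), F => x.
have -> : F x = 1 <-> pres_eq R [:: (x, true)] [::] by apply: pres_classP.
split=> [/R_eq|Nx]; first by rewrite /R /= invg1 !mulg1.
by apply: pres_rel; rewrite /R /= invg1 !mulg1.
Qed.

(** A conjugate of [x] by [c h], with [c] centralizing [x] and [h] in [H], is a
    conjugate by [h]; so all conjugates of [x] in [G] lie in its normal closure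
    in [H]. *)
Lemma normal_closure_normal H x :
    normal_subgroup_of setT H -> H x ->
    (forall g, exists c, commute x c /\ H (c^-1 * g)) ->
  normal_subgroup_of setT (normal_closure_in H x).
Proof.
move=> [sH _ HJ] Hx Hc.
have [[sN NH NJ] Nx] := normal_closure_inP sH Hx.
split=> // g y _ Ny.
have xg : forall g, normal_closure_in H x (x ^ g).
  move=> k; have [c [xc Hk]] := Hc k.
  have xx : x ^ c = x by apply/conjg_fixP/commgP.
  by rewrite -(mulVKg c k) conjgM xx; apply: NJ.
(* The elements that conjugation by [g] sends into the closure form a normal
   subgroup of [H] containing [x], hence contain the closure. *)
suff: normal_closure_in H x `<=`
    [set z | H z /\ normal_closure_in H x (z ^ g)].
  by move=> sub; case: (sub y).
have [H1 HM HV] := sH; have [N1 NM NV] := sN.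
apply: smallest_sub => [|_ ->]; last by split.
split=> [|z []//|h z Hh [Hz Nz]]; first split.
- by split=> //; rewrite conj1g.
- by move=> z t [Hz Nz] [Ht Nt]; split; [apply: HM|rewrite conjMg; apply: NM].
- by move=> z [Hz Nz]; split; [apply: HV|rewrite conjVg; apply: NV].
split; first by rewrite conjgE; apply: HM (HV _ Hh) (HM _ _ Hz Hh).
by rewrite conjJg; apply: NJ => //; apply: HJ.
Qed.

Lemma derived_subgroup_normal : normal_subgroup_of setT (derived_subgroup G).
Proof.
have [D1 DM DV] := derived_subgroup_subgroup G.
split=> // g z _ Dz; have -> : z ^ g = z * [~ z, g] by rewrite commgEl mulVKg.
by apply: DM => //; apply: sub_gen_smallest; exists z, g.
Qed.

End NormalClosure.

(** * Homomorphisms from the braid group *)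

Section BraidMorphism.
Variables (n : nat) (Q : groupType).
Variable f : UMagmaMorphism.type (braid_group n) Q.

Lemma braid_group_ind (P : braid_group n -> Prop) :
    P 1 -> (forall k x, 0 < k < n -> P x -> P (sigma n k * x)) ->
    (forall k x, 0 < k < n -> P x -> P ((sigma n k)^-1 * x)) ->
  forall x, P x.
Proof.
move=> P1 PM PV x; rewrite -[x]pres_classK pres_classE.
elim: (repr x) => [|[i b] w Pw] //=; rewrite -sigmaE.
have lt_i : 0 < i.+1 < n by case: n i {PM PV Pw x w} => [|m] [].
by case: b; [apply: PM|apply: PV].
Qed.

(** If [s_k] and [s_{k+1}] have the same image then the images of [s_{k+1}] and
    [s_{k+2}] commute, because [s_k] and [s_{k+2}] do, and so they coincide. *)
Lemma sigma_morph_const :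
    f (sigma n 1) = f (sigma n 2) ->
  forall k, 0 < k < n -> f (sigma n k) = f (sigma n 1).
Proof.
move=> eq12.
have step k : 0 < k -> k.+1 < n -> f (sigma n k) = f (sigma n k.+1).
  elim: k => // -[//|k] IHk _ lt_kn.
  apply: braid_commute_eq.
    by rewrite -!gmulfM sigma_braid.
  rewrite -IHk //; last exact: ltnW.
  apply: gmulf_commute; apply: sigma_comm; rewrite ?leqnn //.
  by rewrite /= ltnW // ltnW.
elim=> // -[//|k] IHk lt_kn; rewrite -step //; apply: IHk.
by rewrite /= ltnW.
Qed.

Lemma sigma_morph_comm :
  f (sigma n 1) = f (sigma n 2) -> forall x y, commute (f x) (f y).
Proof.
move/sigma_morph_const => eqf; set s := f (sigma n 1) in eqf.
have comm_s : forall x, commute s (f x).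
  elim/braid_group_ind => [|k x kn IHx|k x kn IHx];
    rewrite ?gmulfM ?gmulfV ?gmulf1 ?eqf //.
  - exact: commute1.
  - by apply: commuteM.
  - by apply: commuteM => //; apply: commuteV.
move=> x y; elim/braid_group_ind: y => [|k y kn IHy|k y kn IHy];
  rewrite ?gmulfM ?gmulfV ?gmulf1 ?eqf //.
- exact: commute1.
- by apply: commuteM => //; apply: commute_sym.
- by apply: commuteM => //; apply: commuteV; apply: commute_sym.
Qed.

End BraidMorphism.

(** All the generators agree modulo the commutator subgroup, so every coset of
    it contains a power of [s_k]. *)
Lemma exists_commute_coset n k x :
    2 < n -> 0 < k < n -> commute x (sigma n k) ->
  forall g : braid_group n,
    exists c, commute x c /\ derived_subgroup (braid_group n) (c^-1 * g).
Proof.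
move=> n_gt2 kn xk g.
have [Q [f fP]] := normal_quotient (derived_subgroup_normal (braid_group n)).
have fC y z : commute (f y) (f z).
  apply/commgP/eqP; rewrite -gmulfR; apply/fP.
  by apply: sub_gen_smallest; exists y, z.
suff [c [xc fc]] : exists c, commute x c /\ f c = f g.
  by exists c; split=> //; apply/fP; rewrite gmulfM gmulfV fc mulVg.
have f12 : f (sigma n 1) = f (sigma n 2).
  by apply: braid_commute_eq; rewrite // -!gmulfM sigma_braid.
have fs i : 0 < i < n -> f (sigma n i) = f (sigma n k).
  move=> lt_in.
  by rewrite (sigma_morph_const f12 kn) (sigma_morph_const f12 lt_in).
elim/braid_group_ind: g => [|i g /fs fi [c [xc fc]]|i g /fs fi [c [xc fc]]].
- by exists 1; split=> //; apply: commute1.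
- by exists (sigma n k * c); rewrite !gmulfM fi fc; split=> //; apply: commuteM.
- exists ((sigma n k)^-1 * c); rewrite !gmulfM !gmulfV fi fc; split=> //.
  by apply: commuteM => //; apply: commuteV.
Qed.

(** * The normal closure of the squared quotient of generators *)

Theorem lemma3 (n : nat) (hn : 5 <= n) :
  normal_closure_in (derived_subgroup (braid_group n))
    (((sigma n 2 * (sigma n 1)^-1) ^+ 2)%g : braid_group n)
  = derived_subgroup (braid_group n).
Proof.
have n4 : 4 < n by [].
have n3 := ltnW n4; have n2 := ltnW n3; have n1 := ltnW n2.
set B' := derived_subgroup _; set x := _ ^+ 2.
have B'x : B' x := sigma_quot_derived hn.
have sB' : is_subgroup B' := derived_subgroup_subgroup _.
have [[_ N_B' _] Nx] := normal_closure_inP sB' B'x.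
have x_s4 : commute x (sigma n 4).
  apply/commute_sym; rewrite /x expg2.
  have s4 : commute (sigma n 4) (sigma n 2 * (sigma n 1)^-1).
    apply: commuteM; first by apply: sigma_comm; rewrite ?n2 ?n4.
    by apply: commuteV; apply: sigma_comm; rewrite ?n1 ?n4.
  exact: commuteM.
have nN := normal_closure_normal (derived_subgroup_normal _) B'x
  (@exists_commute_coset n 4 x n2 n4 x_s4).
have [Q [f fP]] := normal_quotient nN.
have fx : (f (sigma n 2) * (f (sigma n 1))^-1) ^+ 2 = 1.
  by rewrite -gmulfF expg2 -gmulfM -expg2; apply/fP.
have braid i : 0 < i -> i.+1 < n ->
    f (sigma n i) * f (sigma n i.+1) * f (sigma n i)
  = f (sigma n i.+1) * f (sigma n i) * f (sigma n i.+1).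
  by move=> *; rewrite -!gmulfM sigma_braid.
have comm i j : 0 < i < n -> 0 < j < n -> (i.+2 <= j) || (j.+2 <= i) ->
    commute (f (sigma n i)) (f (sigma n j)).
  by move=> *; apply/gmulf_commute/sigma_comm.
have f13 : f (sigma n 1) = f (sigma n 3).
  by apply: braid_outer_eq fx; rewrite ?braid //; apply: comm; rewrite ?n1 ?n3.
have f34 : f (sigma n 3) = f (sigma n 4).
  apply: braid_commute_eq; rewrite ?braid // -f13.
  by apply: comm; rewrite ?n1 ?n4.
have f12 : f (sigma n 1) = f (sigma n 2).
  apply: braid_commute_eq; rewrite ?braid // f13 f34.
  by apply: comm; rewrite ?n2 ?n4.
apply/seteqP; split=> //.
apply: smallest_sub; first by case: nN.
move=> _ [y [z ->]]; apply/fP; rewrite gmulfR.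
by apply/eqP/commgP/sigma_morph_comm.
Qed.
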